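(* Let $\varphi:[a,b]\to[a,b]$ where $[a,b]\subset\mathbb{R}$, let $I$ be a convex subset of $\mathbb{R}$, and let $f:I\to\mathbb{R}^{+}$ be a $\log$-$\varphi$-convex function. Then: (i) if $\varphi$ is linear, then $f\circ\varphi$ is $\log$-convex; and (ii) if $f$ is increasing and $\varphi$ is convex, then $f\circ\varphi$ is a $\log$-convex function.
   Context: A function $f:I\to\mathbb{R}^{+}$ is $\log$-$\varphi$-convex if $f(t\varphi(x)+(1-t)\varphi(y))\le[f(\varphi(x))]^{t}[f(\varphi(y))]^{1-t}$ for all $x,y\in I$ and $t\in[0,1]$. A positive function $g$ is $\log$-convex if $g(\lambda x+(1-\lambda)y)\le[g(x)]^{\lambda}[g(y)]^{1-\lambda}$ for all $x,y$ in its domain and $\lambda\in[0,1]$. *)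

(* Defs.v *)
From mathcomp Require Import all_boot all_order all_algebra.
From mathcomp Require Import all_classical all_reals all_analysis.

Set Implicit Arguments.
Unset Strict Implicit.
Unset Printing Implicit Defensive.

Import Order.TTheory GRing.Theory Num.Theory.
Import numFieldNormedType.Exports.

Local Open Scope classical_set_scope.
Local Open Scope ring_scope.

(* Functions on a subset of the line are total functions on R whose values
   outside that subset are never constrained. *)

(* [f : I -> R^+] with [phi] defined on [D]: the points [x], [y] range over the
   elements of [I] at which [phi] is defined, i.e. over [I] when [I `<=` D]. *)
Definition log_phi_convex (R : realType) (D I : set R) (phi f : R -> R) : Prop :=
  (forall x, I x -> 0 < f x) /\
  (forall x y t : R, I x -> D x -> I y -> D y -> 0 <= t <= 1 ->
     f (t * phi x + (1 - t) * phi y) <= f (phi x) `^ t * f (phi y) `^ (1 - t)).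

Definition log_convex (R : realType) (D : set R) (g : R -> R) : Prop :=
  (forall x, D x -> 0 < g x) /\
  (forall x y t : R, D x -> D y -> 0 <= t <= 1 ->
     g (t * x + (1 - t) * y) <= g x `^ t * g y `^ (1 - t)).

(* Linear in the sense of elementary analysis: the constant term may be
   nonzero. *)
Definition linear_on (R : realType) (D : set R) (phi : R -> R) : Prop :=
  exists c d : R, forall x, D x -> phi x = c * x + d.

(* Increasing in the weak sense. *)
Definition increasing_on (R : realType) (D : set R) (f : R -> R) : Prop :=
  {in D &, {homo f : x y / x <= y}}.

(* Main.v *)
Require Import Defs.
From mathcomp Require Import all_boot all_order all_algebra.
From mathcomp Require Import ring lra.
From mathcomp Require Import all_classical all_reals all_analysis.
Import Order.TTheory GRing.Theory Num.Theory.
Import numFieldNormedType.Exports.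
Local Open Scope classical_set_scope.
Local Open Scope ring_scope.

(** Put [z = t * x + (1 - t) * y] and [w = t * phi x + (1 - t) * phi y]. Log-phi-convexity already
    bounds [f w] by the desired geometric mean, so only [f (phi z) <= f w] is missing. For affine
    [phi] the two points coincide; for convex [phi] one has [phi z <= w], and monotonicity of [f]
    concludes. *)

Lemma convex_combR_itv {R : realType} {a b x y t : R} :
  x \in `[a, b] -> y \in `[a, b] -> 0 <= t <= 1 ->
  t * x + (1 - t) * y \in `[a, b].
Proof.
rewrite !in_itv /= => /andP[ax xb] /andP[ay yb] /andP[t0 t1].
by apply/andP; split; nra.
Qed.

Theorem theorem7 (R : realType) (a b : R) (I : set R) (phi f : R -> R)
  (hab : a <= b)
  (hphi : forall x, x \in `[a, b] -> phi x \in `[a, b])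
  (hI : convex_set (I : set R^o))
  (hphiI : forall x, I x -> x \in `[a, b] -> I (phi x))
  (hf : log_phi_convex `[a, b] I phi f) :
  (linear_on `[a, b] phi -> log_convex (I `&` `[a, b]) (f \o phi)) /\
  (increasing_on I f -> convex_function (`[a, b] : set R^o) phi ->
     log_convex (I `&` `[a, b]) (f \o phi)).
Proof.
have [fgt0 fphi] := hf.
have hgt0 x : (I `&` `[a, b]) x -> 0 < (f \o phi) x.
  by move=> [Ix xab]; exact/fgt0/hphiI.
split=> [[c [d phiE]]|fincr phicvx]; split=> // x y t [Ix xab] [Iy yab] t01.
- have zab := convex_combR_itv xab yab t01.
  rewrite /=; suff <- : t * phi x + (1 - t) * phi y = phi (t * x + (1 - t) * y).
    exact: fphi.
  (* The weights sum to 1, so the constant term [d] is preserved. *)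
  by rewrite !phiE//; ring.
- have [t0 t1] := andP t01.
  have zab := convex_combR_itv xab yab t01.
  (* [f] is monotone only on [I], so both [phi z] and [w] must lie there: the former through [z] and
     [hphiI], the latter by convexity of [I]. *)
  have Iz : I (t * x + (1 - t) * y).
    by apply/set_mem/(hI x y (Itv01 t0 t1)); exact/mem_set.
  have Iw : I (t * phi x + (1 - t) * phi y).
    apply/set_mem/(hI (phi x) (phi y) (Itv01 t0 t1)); exact/mem_set/hphiI.
  apply: (le_trans _ (fphi x y t Ix xab Iy yab t01)).
  apply: fincr; [exact/mem_set/hphiI|exact/mem_set|].
  (* The abstract barycentre with weight [Itv01 t0 t1] unfolds to the explicit combination. *)
  by apply: (phicvx (Itv01 t0 t1)); exact/mem_set.
Qed.
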